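(* Let $F$ be a field of characteristic $3$, let $G$ be an abelian group, and let $\Gamma$ be a $G$-grading on the superalgebra $B(4,2)=\mathrm{End}_F(V)\oplus V$ over $F$. Then $\Gamma$ coincides with $\Gamma(G,g)$ for some $g\in G$ and some basis $\{u,v\}$ of $V$ with $(u,v)=1$. Moreover, for $g,h\in G$, $\Gamma(G,g)\cong\Gamma(G,h)$ if and only if $g=h$ or $g=-h$.
   Context: Gradings. A grading by an abelian group $G$ (written additively) on an algebra $\mathcal A$ is a decomposition $\mathcal A=\bigoplus_{g\in G}\mathcal A^g$ into subspaces with $\mathcal A^g\mathcal A^h\subseteq\mathcal A^{g+h}$. A superalgebra is a $\mathbb{Z}_2$-graded algebra $\mathcal A=\mathcal A_{\bar0}\oplus\mathcal A_{\bar1}$ (this is the main grading). A grading on the superalgebra $\mathcal A$ is a group grading on the algebra $\mathcal A$ such that $\mathcal A^g=(\mathcal A^g\cap\mathcal A_{\bar0})\oplus(\mathcal A^g\cap\mathcal A_{\bar1})$ for all $g$. Two $G$-gradings are isomorphic ($\cong$) if there is an isomorphism of superalgebras (an algebra isomorphism preserving the main grading) which, for every $g\in G$, maps the component of degree $g$ of the first onto the component of degree $g$ of the second. The superalgebra $B(4,2)$. Let $V$ be a $2$-dimensional vector space over a field $F$ of characteristic $3$ with a nondegenerate alternating form $(\cdot,\cdot)$. For $\varphi\in\mathrm{End}_F(V)$ put $\bar\varphi=\mathrm{tr}(\varphi)1-\varphi$. Then $B(4,2)=\mathrm{End}_F(V)\oplus V$ with $B(4,2)_{\bar0}=\mathrm{End}_F(V)$,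 $B(4,2)_{\bar1}=V$, and multiplication: composition of maps in $\mathrm{End}_F(V)$; $v\cdot\varphi=\varphi(v)=\bar\varphi\cdot v$ for $\varphi\in\mathrm{End}_F(V)$, $v\in V$; and $u\cdot v\in\mathrm{End}_F(V)$ is the map $w\mapsto(w,u)v$, for $u,v\in V$. The grading $\Gamma(G,g)$. Given a basis $\{u,v\}$ of $V$ with $(u,v)=1$, identify $\mathrm{End}_F(V)$ with $\mathcal M_2(F)$ and let $e_1=\begin{pmatrix}1&0\\0&0\end{pmatrix}$, $e_2=\begin{pmatrix}0&0\\0&1\end{pmatrix}$, $x=\begin{pmatrix}0&1\\0&0\end{pmatrix}$, $y=\begin{pmatrix}0&0\\1&0\end{pmatrix}$. For $g\in G$, $\Gamma(G,g)$ is the $G$-grading on $B(4,2)$ determined by $\deg(e_1)=\deg(e_2)=0$, $\deg(u)=g$, $\deg(v)=-g$, $\deg(x)=2g$, $\deg(y)=-2g$. Up to isomorphism it does not depend on the choice of $\{u,v\}$. *)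

(* Defs.v *)
From HB Require Import structures.
From mathcomp Require Import all_boot all_algebra.

Set Implicit Arguments.
Unset Strict Implicit.
Unset Printing Implicit Defensive.

Import GRing.Theory passmx.
Local Open Scope ring_scope.

(* Finite-dimensional, not necessarily associative algebras are given by a
   vector space A and a multiplication mul : A -> A -> A.  The grading group
   may be infinite, so directness of a family of subspaces is stated over all
   finite duplicate-free lists of degrees. *)
Section Gradings.
Variables (F : fieldType) (A : vectType F) (mul : A -> A -> A).

Definition direct_decomposition (G : zmodType) (Gam : G -> {vspace A}) :=
  (forall a : A, exists (s : seq G) (x : G -> A),
      [/\ uniq s, forall g, x g \in Gam g & a = \sum_(g <- s) x g])
  /\ (forall (s : seq G) (x : G -> A),
        uniq s -> (forall g, x g \in Gam g) -> \sum_(g <- s) x g = 0 ->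
        forall g, g \in s -> x g = 0).

Definition alg_grading (G : zmodType) (Gam : G -> {vspace A}) :=
  direct_decomposition Gam
  /\ (forall g h a b, a \in Gam g -> b \in Gam h -> mul a b \in Gam (g + h)).

(* A superalgebra is an algebra with a distinguished 'Z_2-grading [main]; the
   sum in the second clause is then automatically direct. *)
Definition superalg_grading (main : 'Z_2 -> {vspace A})
    (G : zmodType) (Gam : G -> {vspace A}) :=
  alg_grading Gam
  /\ (forall g, Gam g = (Gam g :&: main 0%R + Gam g :&: main 1%R)%VS).

(* Isomorphism of two gradings on the same superalgebra. *)
Definition superalg_grading_iso (main : 'Z_2 -> {vspace A})
    (G : zmodType) (Gam Gam' : G -> {vspace A}) :=
  exists f : 'End(A),
    [/\ bijective f,
        forall a b, f (mul a b) = mul (f a) (f b),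
        forall i, (f @: main i)%VS = main i
      & forall g, (f @: Gam g)%VS = Gam' g].

End Gradings.

Section Endomorphisms.
Variables (F : fieldType) (V : vectType F).

Definition end_tr (phi : 'End(V)) : F :=
  \tr (mxof (vbasis {:V}) (vbasis {:V}) phi).

Lemma end_tr_linear : linear_for *%R end_tr.
Proof. by move=> a f g; rewrite /end_tr !linearP. Qed.
HB.instance Definition _ := GRing.isSemilinear.Build F _ _ _ end_tr
  (GRing.semilinear_linear end_tr_linear).

Lemma end_tr_basis (e : (\dim {:V}).-tuple V) (phi : 'End(V)) :
  basis_of {:V} e -> end_tr phi = \tr (mxof e e phi).
Proof.
move=> eb; have vb := vbasisP {:V}.
have h1 : mxof (vbasis {:V}) (vbasis {:V}) phi =
   mxof (vbasis {:V}) e \1%VF *m (mxof e e phi *m mxof e (vbasis {:V}) \1%VF).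
  rewrite -(mxof_comp _ _ eb) // -(mxof_comp _ _ eb) //.
  by rewrite comp_lfun1r comp_lfun1l.
rewrite /end_tr h1 mxtrace_mulC -mulmxA -(mxof_comp _ _ vb) // comp_lfun1l.
suff -> : mxof e e (\1%VF : 'End(V)) = 1%:M by rewrite mulmx1.
apply/row_matrixP=> i; rewrite !rowE mul_mxof lfunE /= vecof_delta rVofE //.
by rewrite mulmx1.
Qed.

Definition bar_end (phi : 'End(V)) : 'End(V) := end_tr phi *: \1%VF - phi.

(* The endomorphism whose matrix in the basis X is M, acting on columns of
   coordinates: it maps X_j to \sum_i M i j *: X_i.  (The library's [hommx]
   acts on rows.) *)
Definition end_of_mx n (X : n.-tuple V) (M : 'M[F]_n) : 'End(V) :=
  linfun (fun w => \sum_i (\sum_j M i j * coord X j w) *: X`_i).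

Lemma end_of_mxE n (X : n.-tuple V) M w :
  end_of_mx X M w = \sum_i (\sum_j M i j * coord X j w) *: X`_i.
Proof.
have lin : linear (fun w => \sum_i (\sum_j M i j * coord X j w) *: X`_i).
  move=> a w1 w2; rewrite scaler_sumr -big_split /=; apply: eq_bigr => i _.
  rewrite scalerA -scalerDl mulr_sumr -big_split /=; congr (_ *: _).
  by apply: eq_bigr => j _; rewrite linearP mulrDr mulrCA.
pose lf : {linear V -> V} := HB.pack (fun w => _)
  (GRing.isSemilinear.Build F _ _ _ _ (GRing.semilinear_linear lin)).
exact: (lfunE lf w).
Qed.

Lemma end_of_mx_basis n (X : n.-tuple V) M (j : 'I_n) :
  free X -> end_of_mx X M X`_j = \sum_i M i j *: X`_i.
Proof.
move=> fX; rewrite end_of_mxE; apply: eq_bigr => i _; congr (_ *: _).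
rewrite (bigD1 j) //= coord_free // eqxx mulr1 big1 ?addr0 // => k /negPf nk.
by rewrite coord_free // eq_sym nk mulr0.
Qed.

End Endomorphisms.

Section B42.
Variables (F : fieldType) (V : vectType F).

Definition alternating (b : V -> V -> F) := forall v, b v v = 0.

Definition nondegenerate_form (b : V -> V -> F) :=
  forall v, (forall w, b v w = 0) -> v = 0.

Definition symplectic_basis (b : V -> V -> F) (u v : V) :=
  basis_of {:V} [:: u; v] /\ b u v = 1.

Definition B42 : vectType F := ('End(V) * V)%type.

Variable b : {biscalar V}.

Definition odd_mul (u v : V) : 'End(V) := linfun (fun w => b w u *: v).

Lemma odd_mulE u v w : odd_mul u v w = b w u *: v.
Proof.
have lin : linear (fun w => b w u *: v).
  by move=> a w1 w2; rewrite linearPl scalerDl scalerA.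
pose lf : {linear V -> V} := HB.pack (fun w => _)
  (GRing.isSemilinear.Build F _ _ _ _ (GRing.semilinear_linear lin)).
exact: (lfunE lf w).
Qed.

(* The defining rule bar(phi) . v = phi(v) reads phi . v = bar(phi)(v), as bar
   is an involution (see [bar_endK]). *)
Definition B42_mul (a c : B42) : B42 :=
  ((a.1 \o c.1)%VF + odd_mul a.2 c.2, c.1 a.2 + bar_end a.1 c.2).

Definition B42_main (i : 'Z_2) : {vspace B42} :=
  if i == 0 then lker (linfun (snd : B42 -> V))
  else lker (linfun (fst : B42 -> 'End(V))).

Lemma mem_B42_even (a : B42) : (a \in B42_main 0) = (a.2 == 0).
Proof. by rewrite /B42_main eqxx memv_ker lfunE. Qed.

Lemma mem_B42_odd (a : B42) : (a \in B42_main 1) = (a.1 == 0).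
Proof. by rewrite /B42_main /= memv_ker lfunE. Qed.

(* e1, e2, u, v, x = E_12 and y = E_21, paired with their degrees in
   Gamma(G, g). *)
Definition Gamma_degrees (u v : V) (G : zmodType) (g : G) : seq (B42 * G) :=
  let E (i j : 'I_2) := end_of_mx [tuple u; v] (delta_mx i j) in
  [:: ((E 0 0, 0), 0); ((E 1 1, 0), 0);
      ((0, u), g); ((0, v), - g);
      ((E 0 1, 0), g *+ 2); ((E 1 0, 0), - (g *+ 2))].

Definition Gamma (u v : V) (G : zmodType) (g : G) (k : G) : {vspace B42} :=
  <<[seq p.1 | p <- Gamma_degrees u v g & p.2 == k]>>%VS.

End B42.

Lemma bar_endK (F : fieldType) (V : vectType F) (phi : 'End(V)) :
  \dim {:V} = 2%N -> bar_end (bar_end phi) = phi.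
Proof.
move=> d2; have vb := vbasisP {:V}.
have tr1 : end_tr (\1%VF : 'End(V)) = 2%:R.
  rewrite /end_tr; suff -> : mxof (vbasis {:V}) (vbasis {:V}) \1%VF = 1%:M.
    by rewrite mxtrace1 d2.
  apply/row_matrixP=> i; rewrite !rowE mul_mxof lfunE /= vecof_delta rVofE //.
  by rewrite mulmx1.
have trl : end_tr (bar_end phi) = end_tr phi.
  transitivity (end_tr phi * end_tr (\1%VF : 'End(V)) - end_tr phi).
    by rewrite [in LHS]/bar_end linearB linearZ.
  by rewrite tr1 mulr_natr mulr2n addrK.
by rewrite {1}/bar_end trl /bar_end opprB addrC subrK.
Qed.

Lemma B42_main_grading (F : fieldType) (V : vectType F) (b : {biscalar V}) :
  alg_grading (B42_mul b) (B42_main V).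
Proof.
have F2 (i : 'Z_2) : i = 0 \/ i = 1.
  by case: i => [[|[|//]] ?]; [left|right]; apply: val_inj.
have ml v : odd_mul b v 0 = 0 by apply/lfunP=> w; rewrite odd_mulE scaler0 lfunE.
have mr v : odd_mul b 0 v = 0.
  by apply/lfunP=> w; rewrite odd_mulE linear0r scale0r lfunE.
have bar0 : bar_end (0 : 'End(V)) = 0.
  by rewrite /bar_end linear0 scale0r subr0.
split; first split.
- move=> a; exists [:: 0; 1], (fun i => if i == 0 then (a.1, 0) else (0, a.2)).
  split=> //.
    by move=> g; case: (F2 g) => ->; rewrite ?mem_B42_even ?mem_B42_odd /=.
  by rewrite big_cons big_seq1 /=; case: a => a1 a2; congr (_, _);
     rewrite /= ?addr0 ?add0r.
- move=> s x us xm sx g gs.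
  have xe : x 0 = ((x 0).1, 0).
    by case: (x 0) (xm 0) => p q; rewrite mem_B42_even => /eqP /= ->.
  have xo : x 1 = (0, (x 1).2).
    by case: (x 1) (xm 1) => p q; rewrite mem_B42_odd => /eqP /= ->.
  have s1 : (\sum_(i <- s) x i).1 = \sum_(i <- s) (x i).1.
    by rewrite (raddf_sum (@fst 'End(V) V)).
  have s2 : (\sum_(i <- s) x i).2 = \sum_(i <- s) (x i).2.
    by rewrite (raddf_sum (@snd 'End(V) V)).
  case: (F2 g) gs => -> gs.
    move: s1; rewrite sx (big_rem _ gs) /= big_seq big1 ?addr0 => [e0|i].
      by rewrite xe -e0.
    by rewrite mem_rem_uniq // => /andP[]; case: (F2 i) => -> //; rewrite xo.
  move: s2; rewrite sx (big_rem _ gs) /= big_seq big1 ?addr0 => [e0|i].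
    by rewrite xo -e0.
  by rewrite mem_rem_uniq // => /andP[]; case: (F2 i) => -> //; rewrite xe.
have t2 : 1 + 1 = 0 :> 'Z_2 by apply: val_inj.
move=> g h [a1 a2] [c1 c2].
case: (F2 g) => ->; case: (F2 h) => ->; rewrite ?add0r ?addr0 ?t2.
- by rewrite !mem_B42_even /= => /eqP-> /eqP->; rewrite !linear0 addr0.
- rewrite mem_B42_even !mem_B42_odd /= => /eqP-> /eqP->.
  by rewrite comp_lfun0r mr addr0.
- rewrite mem_B42_even !mem_B42_odd /= => /eqP-> /eqP->.
  by rewrite comp_lfun0l ml addr0.
- rewrite !mem_B42_odd mem_B42_even /= => /eqP-> /eqP->.
  by rewrite bar0 !zero_lfunE addr0.
Qed.

(* Main.v *)
(* If u, v are homogeneous odd vectors with (u, v) = 1, then v(uv) = -v, so uv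
   has degree 0 and deg v = - deg u =: -g.  The products uv, vu, uu, vv are, up
   to sign, the matrix units e2, e1, x, y of the basis {u, v}; hence the grading
   contains Gamma(G, g) componentwise and, both being direct decompositions, is
   equal to it.  Such u, v exist because the odd part of the grading spans V and
   the form is nonzero.
   The symplectic group acts on B(4,2) by automorphisms, so Gamma(G, g) is
   independent of the basis, and passing from {u, v} to {v, -u} exchanges g and
   -g.  Conversely g and -g are the only degrees of Gamma(G, g) whose component
   contains nonzero odd elements. *)
Require Import Defs.
From HB Require Import structures.
From mathcomp Require Import all_boot all_algebra.

Set Implicit Arguments.
Unset Strict Implicit.
Unset Printing Implicit Defensive.

Import GRing.Theory.
Local Open Scope ring_scope.

(** An element of [Gam k] is expanded over [L] and its terms are grouped by degree; uniqueness of
    homogeneous components leaves only the terms of degree [k]. This upgrades an inclusion of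
    components to an equality. *)
Lemma direct_decomposition_span (F : fieldType) (A : vectType F) (G : zmodType)
    (Gam : G -> {vspace A}) (L : seq (A * G)) :
  direct_decomposition Gam ->
  {in L, forall p, p.1 \in Gam p.2} ->
  (forall a, a \in <<[seq p.1 | p <- L]>>%VS) ->
  forall k, Gam k = <<[seq p.1 | p <- L & p.2 == k]>>%VS.
Proof.
move=> [_ dir] homL spanL k; apply: subv_anti; apply/andP; split; last first.
  apply/span_subvP => a /mapP[p]; rewrite mem_filter => /andP[/eqP <- pL] ->.
  exact: homL.
apply/subvP => a ak.
have := spanL a.
rewrite -[[seq _ | _ <- _]]/(val (in_tuple [seq p.1 | p <- L])).
move=> /coord_span; set c := coord _ => aE.
pose n := size [seq p.1 | p <- L].
have nE (i : 'I_n) : (i < size L)%N by rewrite -(size_map fst) ltn_ord.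
pose d (i : 'I_n) : G := (nth (0, 0) L i).2.
pose t (i : 'I_n) : A := c i a *: [seq p.1 | p <- L]`_i.
have tE i : t i \in Gam (d i).
  by rewrite /t (nth_map (0, 0)) // memvZ // homL ?mem_nth.
(* [k] is added explicitly, since it need not be the degree of any element of [L]. *)
pose s := undup (k :: [seq p.2 | p <- L]).
have ds i : d i \in s.
  by rewrite mem_undup in_cons; apply/orP; right; apply/map_f/mem_nth.
have us : uniq s by apply: undup_uniq.
have ks : k \in s by rewrite mem_undup mem_head.
have pick (T : zmodType) (x : T) g : g \in s ->
    \sum_(h <- s) (if g == h then x else 0) = x.
  move=> gs; rewrite (bigD1_seq g) //= eqxx big1 ?addr0 // => h.
  by rewrite eq_sym => /negPf ->.
pose x g := \sum_(i | d i == g) t i.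
have xsum : \sum_(g <- s) x g = a.
  under eq_bigr => g _ do rewrite /x big_mkcond.
  rewrite exchange_big [RHS]aE /=; apply: eq_bigr => i _.
  exact: pick.
have xk : x k = a.
  apply/eqP; rewrite -subr_eq0; apply/eqP.
  (* Directness is applied to the components [x g] with [a] subtracted in degree [k], a family with
     sum zero. *)
  have := dir s (fun g => x g - (if k == g then a else 0)) us _ _ k ks.
  rewrite eqxx; apply.
    move=> g; rewrite memvB //; last by case: eqP => [<-|_]; rewrite ?mem0v.
    by apply: memv_suml => i /eqP <-.
  by rewrite sumrB xsum pick // subrr.
rewrite -xk; apply: memv_suml => i /eqP dk.
rewrite memvZ // memv_span // (nth_map (0, 0)) //; apply: map_f.
by rewrite mem_filter -dk eqxx mem_nth.
Qed.

(** * Symplectic bases and the generators of Gamma(G, g) *)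

Section Symplectic.
Variables (F : fieldType) (V : vectType F) (b : {biscalar V}).
Hypothesis b_alt : alternating b.

Lemma alternating_sym u v : b u v = - b v u.
Proof.
have := b_alt (u + v).
rewrite linearDl !linearDr /= !b_alt add0r addr0 => /eqP.
by rewrite addr_eq0 => /eqP.
Qed.

Lemma symplectic_basis_rev u v : symplectic_basis b u v -> b v u = - 1.
Proof. by case=> _ buv; rewrite alternating_sym buv. Qed.

(** Pairing [w] with [v] and with [u] isolates its two coordinates. *)
Lemma symplectic_basisE u v w :
  symplectic_basis b u v -> w = b w v *: u - b w u *: v.
Proof.
move=> uv; have vu := symplectic_basis_rev uv; case: uv => uvb buv.
have : w \in <<[:: u; v]>>%VS by rewrite (span_basis uvb) memvf.
rewrite span_cons span_seq1 => /memv_addP[_ /vlineP[p ->] [_ /vlineP[q ->] ->]].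
rewrite !linearDl /= !linearZl_LR /= !b_alt buv vu.
by rewrite !mulr0 !mulr1 add0r addr0 mulrN1 scaleNr opprK.
Qed.

Lemma symplectic_basis_intro u v :
  \dim {:V} = 2%N -> b u v = 1 -> symplectic_basis b u v.
Proof.
move=> d2 buv; split=> //; rewrite basisEfree subvf d2 /= andbT.
rewrite free_cons span_seq1 free_cons span_nil memv0 nil_free andbT.
apply/andP; split; last first.
  by apply: contra_eq_neq buv => ->; rewrite linear0r eq_sym oner_eq0.
apply/negP => /vlineP[k uE]; move: buv.
by rewrite uE linearZl_LR /= b_alt mulr0 => /eqP; rewrite eq_sym oner_eq0.
Qed.

(** The scalar [c] is a sign: [c = 1] gives the quarter turn to {v, -u}, and [c = -1] gives the
    inverse turn. *)
Lemma symplectic_basis_rot u v (c : F) : c * c = 1 ->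
  \dim {:V} = 2%N -> symplectic_basis b u v ->
  symplectic_basis b (c *: v) (- c *: u).
Proof.
move=> cc d2 uv; apply: symplectic_basis_intro => //.
rewrite linearZl_LR linearZr_LR /= (symplectic_basis_rev uv).
by rewrite mulrN1 opprK.
Qed.

Lemma odd_mulZ u v c d : odd_mul b (c *: u) (d *: v) = (c * d) *: odd_mul b u v.
Proof.
apply/lfunP => z; rewrite lfunE /= !odd_mulE linearZr_LR /= !scalerA.
by rewrite mulrAC.
Qed.

(** Since the coordinates of [w] are [b w v] and [- b w u], every matrix unit is a signed product of
    two basis vectors. Facts about the even generators thus reduce to facts about [u] and [v]. *)
Lemma Gamma_degreesE u v (G : zmodType) (g : G) : symplectic_basis b u v ->
  Gamma_degrees u v g =
  [:: ((odd_mul b v u, 0), 0); ((- odd_mul b u v, 0), 0);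
      ((0, u), g); ((0, v), - g);
      ((- odd_mul b u u, 0), g *+ 2); ((odd_mul b v v, 0), - (g *+ 2))].
Proof.
move=> uv; pose X := [tuple u; v].
have fX : free X by case: uv => /basis_free.
have EE (i j : 'I_2) w :
    end_of_mx X (delta_mx i j) w = coord X j w *: X`_i.
  rewrite end_of_mxE (bigD1 i) //= [X in _ + X]big1 ?addr0 => [|k /negPf ki].
    rewrite (bigD1 j) //= mxE !eqxx mul1r big1 ?addr0 // => k /negPf kj.
    by rewrite mxE kj andbF mul0r.
  by rewrite big1 ?scale0r // => l _; rewrite mxE ki mul0r.
have cE (j : 'I_2) w : coord X j w = if j == 0%R then b w v else - b w u.
  rewrite [in LHS](symplectic_basisE w uv) linearB !linearZ /=.
  have -> : coord X j u = (0%R == j)%:R by exact: (coord_free 0%R j fX).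
  have -> : coord X j v = (1%R == j)%:R by exact: (coord_free 1%R j fX).
  by case: j => [[|[|//]] ?] /=; rewrite ?mulr0 ?mulr1 ?subr0 ?sub0r.
rewrite /Gamma_degrees; congr [:: ((_, _), _); ((_, _), _); _; _; ((_, _), _);
  ((_, _), _)]; apply/lfunP => w;
  by rewrite EE cE /= ?opp_lfunE odd_mulE ?scaleNr.
Qed.

Lemma span_Gamma_degrees u v (G : zmodType) (g : G) (a : B42 V) :
  symplectic_basis b u v ->
  a \in <<[seq p.1 | p <- Gamma_degrees u v g]>>%VS.
Proof.
move=> uv; rewrite (Gamma_degreesE _ uv) /=; set L := [:: _; _; _; _; _; _].
have inL i c : c *: L`_i \in <<L>>%VS.
  rewrite memvZ //; case: (ltnP i (size L)) => iL.
    by rewrite memv_span ?mem_nth.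
  by rewrite nth_default ?mem0v.
case: a => f w.
(* With their signs, the four coefficients are the matrix entries of [f] in the basis {u, v}. *)
have fE : f = b (f u) v *: odd_mul b v u - b (f u) u *: odd_mul b v v
             + b (f v) v *: (- odd_mul b u u) - b (f v) u *: (- odd_mul b u v).
  apply/lfunP => z.
  rewrite !(add_lfunE, opp_lfunE, scale_lfunE, odd_mulE).
  rewrite {1}(symplectic_basisE z uv) linearB !linearZ /=.
  rewrite {1}(symplectic_basisE (f u) uv) {1}(symplectic_basisE (f v) uv).
  rewrite opprB !scalerBr !scalerN !opprK !scalerA !addrA !(mulrC (b z _)).
  by rewrite addrAC.
have -> : (f, w) = b (f u) v *: L`_0 - b (f u) u *: L`_5
   + b (f v) v *: L`_4 - b (f v) u *: L`_1
   + b w v *: L`_2 - b w u *: L`_3 :> B42 V.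
  congr (_, _) => /=; first by rewrite !scaler0 subr0 addr0 -fE.
  by rewrite !scaler0 !(subr0, addr0, add0r) -symplectic_basisE.
by rewrite !(memvB, memvD, inL).
Qed.

(** The quarter turn exchanges e1 with e2, u with v and x with y up to sign; replacing [g] by [- g]
    restores the degrees. *)
Lemma Gamma_rot_sub u v (c : F) (G : zmodType) (g k : G) : c * c = 1 ->
  \dim {:V} = 2%N -> symplectic_basis b u v ->
  (Gamma u v g k <= Gamma (c *: v) (- c *: u) (- g) k)%VS.
Proof.
move=> cc d2 uv; have vu := symplectic_basis_rot cc d2 uv.
apply/span_subvP => a /mapP[p]; rewrite mem_filter => /andP[/eqP pk pL] ->.
suff [q qL [qk [d ->]]] :
    exists2 q, q \in Gamma_degrees (c *: v) (- c *: u) (- g) &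
      q.2 = k /\ exists d, p.1 = d *: q.1.
  by rewrite memvZ // memv_span // map_f // mem_filter qk eqxx.
move: pL; rewrite -pk {k pk} !Gamma_degreesE // !odd_mulZ.
rewrite !(mulNr, mulrN, cc, scaleN1r, scale1r, opprK, mulNrn).
rewrite !inE => /or4P[| | |/or3P[| |]] /eqP -> /=.
- exists ((odd_mul b v u, 0), 0); first by apply/(nthP (0, 0)); exists 1%N.
  by split=> //; exists 1; rewrite scale1r.
- exists ((- odd_mul b u v, 0), 0); first by apply/(nthP (0, 0)); exists 0%N.
  by split=> //; exists 1; rewrite scale1r.
- exists ((0, - c *: u), g); first by apply/(nthP (0, 0)); exists 3%N.
  split=> //; exists (- c); congr (_, _) => /=; first by rewrite scaler0.
  by rewrite scalerA mulrNN cc scale1r.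
- exists ((0, c *: v), - g); first by apply/(nthP (0, 0)); exists 2%N.
  split=> //; exists c; congr (_, _) => /=; first by rewrite scaler0.
  by rewrite scalerA cc scale1r.
- exists ((odd_mul b u u, 0), g *+ 2); first by apply/(nthP (0, 0)); exists 5%N.
  by split=> //; exists (- 1); congr (_, _); rewrite /= ?scaler0 ?scaleN1r.
- exists ((- odd_mul b v v, 0), - (g *+ 2));
    first by apply/(nthP (0, 0)); exists 4%N.
  split=> //; exists (- 1); congr (_, _); rewrite /= ?scaler0 //.
  by rewrite scaleN1r opprK.
Qed.

Lemma Gamma_rot u v (G : zmodType) (g k : G) :
  \dim {:V} = 2%N -> symplectic_basis b u v ->
  Gamma u v g k = Gamma v (- u) (- g) k.
Proof.
move=> d2 uv; apply: subv_anti; apply/andP; split.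
  by have := Gamma_rot_sub g k (mulr1 1) d2 uv; rewrite scale1r scaleN1r.
(* For the reverse inclusion, the inverse turn [c = -1] brings {v, -u} back to {u, v}. *)
have := symplectic_basis_rot (mulr1 1) d2 uv; rewrite scale1r scaleN1r => vu.
have N1 : - 1 * - 1 = 1 :> F by rewrite mulrNN mulr1.
by have := Gamma_rot_sub (- g) k N1 d2 vu; rewrite scaleN1r !opprK scale1r.
Qed.

Lemma mul_odd u v : B42_mul b (0, u) (0, v) = (odd_mul b u v, 0).
Proof.
congr (_, _); first by rewrite /= comp_lfun0l add0r.
by rewrite /= /bar_end linear0 scale0r subr0 !zero_lfunE addr0.
Qed.

Lemma mul_odd_even v (f : 'End(V)) : B42_mul b (0, v) (f, 0) = (0, f v).
Proof.
congr (_, _) => /=; last by rewrite linear0 addr0.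
by rewrite comp_lfun0l add0r; apply/lfunP => w; rewrite odd_mulE scaler0 lfunE.
Qed.

(** * Homogeneous odd vectors in an arbitrary grading *)

Section Grading.
Variables (G : zmodType) (Gam : G -> {vspace B42 V}).
Hypothesis Gam_grading : superalg_grading (B42_mul b) (B42_main V) Gam.

Lemma grading_odd_part g (a : B42 V) : a \in Gam g -> (0, a.2) \in Gam g.
Proof.
case: Gam_grading => _ split_g; rewrite {1}split_g.
case/memv_addP => x /memv_capP[_]; rewrite mem_B42_even => /eqP x2.
case=> y /memv_capP[yg]; rewrite mem_B42_odd => /eqP y1 -> /=.
by rewrite x2 add0r -y1 -surjective_pairing.
Qed.

Lemma grading_deg_inj g h a : a \in Gam g -> a \in Gam h -> a != 0 -> g = h.
Proof.
case: Gam_grading => -[[_ dir] _] _ ag ah a0; apply/eqP.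
apply: contra_neqT a0 => gh.
(* If [g] and [h] differed, [a] in degree [g] and [- a] in degree [h] would be nonzero components
   with sum zero. *)
have := dir [:: g; h]
  (fun k => if k == g then a else if k == h then - a else 0).
move=> /(_ _ _ _ g); rewrite eqxx mem_head; apply=> //=.
- by rewrite inE gh.
- move=> k; case: eqP => [->|_] //.
  by case: eqP => [->|_]; rewrite ?memvN ?mem0v.
- by rewrite big_cons big_seq1 eqxx [h == g]eq_sym (negPf gh) eqxx subrr.
Qed.

(** By bilinearity, [b w z] is a sum of pairings of odd parts of homogeneous elements, so one of
    these is nonzero. *)
Lemma homogeneous_nonorthogonal w z : b w z != 0 ->
  exists g h u v, [/\ (0, u) \in Gam g, (0, v) \in Gam h & b u v != 0].
Proof.
case: (Gam_grading) => -[[dec _] _] _ wz.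
have [s [x [_ xg wE]]] := dec (0, w); have [t [y [_ yg zE]]] := dec (0, z).
have {}wE : w = \sum_(g <- s) (x g).2.
  by rewrite -(raddf_sum (@snd 'End(V) V)) -wE.
have {}zE : z = \sum_(g <- t) (y g).2.
  by rewrite -(raddf_sum (@snd 'End(V) V)) -zE.
have : has (fun g => has (fun h => b (x g).2 (y h).2 != 0) t) s.
  apply: contra_neqT wz => /hasPn orth; rewrite wE linear_sumlz big_seq big1 //.
  move=> g /orth /hasPn orthg; rewrite zE linear_sumr big_seq big1 //.
  by move=> h /orthg; rewrite negbK => /eqP.
case/hasP => g _ /hasP[h _ ne0]; exists g, h, (x g).2, (y h).2.
by split=> //; apply: grading_odd_part.
Qed.

Lemma grading_eq_Gamma g h u v : symplectic_basis b u v ->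
  (0, u) \in Gam g -> (0, v) \in Gam h -> Gam =1 Gamma u v g.
Proof.
move=> uv ug vh; have [dir mulG] := Gam_grading.1.
have hg : h = - g.
  (* This product is [- v], so the nonzero vector [v] has both degree [h] and degree
     [h + (g + h)]. *)
  have : B42_mul b (0, v) (B42_mul b (0, u) (0, v)) \in Gam (h + (g + h)).
    by rewrite !mulG.
  rewrite mul_odd mul_odd_even odd_mulE (symplectic_basis_rev uv) scaleN1r.
  have -> : (0, - v) = - (0, v) :> B42 V by congr (_, _); rewrite /= oppr0.
  rewrite memvN => /(grading_deg_inj vh) E.
  apply/eqP; rewrite -addr_eq0 addrC; apply/eqP/(addrI h); rewrite addr0 -E //.
  have := uv.2; apply: contra_eq_neq => -[->].
  by rewrite linear0r eq_sym oner_eq0.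
subst h; apply: direct_decomposition_span => //; last first.
  by move=> a; apply: span_Gamma_degrees.
have evenN f k : (f, 0) \in Gam k -> (- f, 0) \in Gam k.
  have -> : (- f, 0) = - (f, 0) :> B42 V by congr (_, _); rewrite /= oppr0.
  by rewrite memvN.
have g0 : 0 = g + - g by rewrite subrr.
move=> p; rewrite Gamma_degreesE // !inE => /or4P[| | |/or3P[| |]] /eqP -> //=.
- by rewrite -mul_odd g0 addrC mulG.
- by rewrite evenN // -mul_odd g0 mulG.
- by rewrite evenN // -mul_odd mulr2n mulG.
- by rewrite -mul_odd mulr2n opprD mulG.
Qed.

End Grading.

End Symplectic.

(** * The action of the symplectic group by automorphisms *)

Section Conjugation.
Variables (F : fieldType) (V : vectType F).

Lemma end_tr_mulC (f g : 'End(V)) : end_tr (f \o g)%VF = end_tr (g \o f)%VF.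
Proof.
by rewrite /end_tr !(passmx.mxof_comp _ _ (vbasisP {:V})) mxtrace_mulC.
Qed.

(** [T] stands for the inverse of [S]; as a separate argument, it lets the inverse map be obtained
    by exchanging the two. *)
Definition conj_B42 (S T : 'End(V)) : 'End(B42 V) :=
  linfun (fun a : B42 V => ((S \o a.1 \o T)%VF, S a.2)).

Lemma conj_B42E S T a : conj_B42 S T a = ((S \o a.1 \o T)%VF, S a.2).
Proof.
have lin : linear (fun a : B42 V => ((S \o a.1 \o T)%VF, S a.2) : B42 V).
  move=> c x y; congr (_, _); last exact: linearP.
  by rewrite /= comp_lfunDr comp_lfunDl -comp_lfunZr -comp_lfunZl.
pose lf : {linear B42 V -> B42 V} := HB.pack (fun a => _)
  (GRing.isSemilinear.Build F _ _ _ _ (GRing.semilinear_linear lin)).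
exact: (lfunE lf a).
Qed.

Lemma conj_B42K S T :
  (T \o S)%VF = \1%VF -> cancel (conj_B42 S T) (conj_B42 T S).
Proof.
move=> TS a; rewrite !conj_B42E /= -!comp_lfunA TS comp_lfun1r comp_lfunA TS.
by rewrite comp_lfun1l -comp_lfunE TS id_lfunE -surjective_pairing.
Qed.

Variables (b : {biscalar V}) (S T : 'End(V)).
Hypotheses (TS : (T \o S)%VF = \1%VF) (ST : (S \o T)%VF = \1%VF).
Hypothesis isoS : forall w z, b (S w) (S z) = b w z.

(** As [S] is an isometry with inverse [T], pairing [T w] with [u] amounts to pairing [w] with
    [S u]. *)
Lemma conj_odd_mul u v : (S \o odd_mul b u v \o T)%VF = odd_mul b (S u) (S v).
Proof.
apply/lfunP => w; rewrite !comp_lfunE !odd_mulE linearZ -isoS.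
by rewrite -[S (T w)]comp_lfunE ST id_lfunE.
Qed.

(** Conjugation preserves the trace, hence commutes with [bar_end]; the odd products are handled by
    [conj_odd_mul]. *)
Lemma conj_B42M a c :
  conj_B42 S T (B42_mul b a c) = B42_mul b (conj_B42 S T a) (conj_B42 S T c).
Proof.
have TSK w : T (S w) = w by rewrite -comp_lfunE TS id_lfunE.
rewrite !conj_B42E /B42_mul /=; congr (_, _).
  rewrite comp_lfunDr comp_lfunDl conj_odd_mul; congr (_ + _).
  by apply/lfunP => w; rewrite !comp_lfunE TSK.
rewrite linearD !comp_lfunE TSK; congr (_ + _).
rewrite /bar_end; have -> : end_tr (S \o a.1 \o T)%VF = end_tr a.1.
  by rewrite end_tr_mulC comp_lfunA TS comp_lfun1l.
rewrite !(add_lfunE, opp_lfunE, scale_lfunE, id_lfunE) !comp_lfunE TSK.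
by rewrite linearB linearZ.
Qed.

Lemma conj_B42_main i : (conj_B42 S T @: B42_main V i)%VS = B42_main V i.
Proof.
(* Arbitrary [S'] and [T'] allow use for both the map and its inverse, one for each inclusion. *)
have pres S' T' a : a \in B42_main V i -> conj_B42 S' T' a \in B42_main V i.
  have [->|->] : i = 0 \/ i = 1.
  - by case: i => [[|[|//]] ?]; [left|right]; apply: val_inj.
  - by rewrite !mem_B42_even conj_B42E => /eqP /= ->; rewrite linear0.
  - rewrite !mem_B42_odd conj_B42E => /eqP /= ->.
    by rewrite comp_lfun0r comp_lfun0l.
apply: subv_anti; apply/andP; split; apply/subvP => a.
  by case/memv_imgP => c ci ->; apply: pres.
by move=> ai; rewrite -(conj_B42K ST a) memv_img // pres.
Qed.

Lemma conj_B42_Gamma u v (G : zmodType) (g k : G) : alternating b ->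
  symplectic_basis b u v -> symplectic_basis b (S u) (S v) ->
  (conj_B42 S T @: Gamma u v g k)%VS = Gamma (S u) (S v) g k.
Proof.
move=> b_alt uv Suv; rewrite /Gamma limg_span.
have -> : Gamma_degrees (S u) (S v) g =
    [seq (conj_B42 S T p.1, p.2) | p <- Gamma_degrees u v g].
  rewrite !(Gamma_degreesE b_alt) //= !conj_B42E /= !comp_lfun0r !comp_lfun0l.
  by rewrite !linear0 !(comp_lfunNr, comp_lfunNl) !conj_odd_mul.
by rewrite filter_map -!map_comp.
Qed.

End Conjugation.

(** * Isomorphisms between the gradings Gamma(G, g) *)

Section Isomorphism.
Variables (F : fieldType) (V : vectType F) (b : {biscalar V}) (G : zmodType).
Hypothesis b_alt : alternating b.

Lemma Gamma_iso_same_degree u v u' v' (g : G) :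
  symplectic_basis b u v -> symplectic_basis b u' v' ->
  superalg_grading_iso (B42_mul b) (B42_main V) (Gamma u v g) (Gamma u' v' g).
Proof.
move=> uv uv'.
(* The linear map taking [p] to [p'] and [q] to [q'], with the coordinates of [symplectic_basisE]
   encoded as odd products. *)
pose change p q p' q' : 'End(V) := odd_mul b q p' - odd_mul b p q'.
have changeE p q p' q' w : change p q p' q' w = b w q *: p' - b w p *: q'.
  by rewrite add_lfunE opp_lfunE !odd_mulE.
have changeK p q p' q' : symplectic_basis b p q -> symplectic_basis b p' q' ->
    (change p' q' p q \o change p q p' q')%VF = \1%VF.
  move=> pq pq'; apply/lfunP => w; rewrite comp_lfunE id_lfunE !changeE.
  rewrite !linearBl /= !linearZl_LR /= !b_alt pq'.2.
  rewrite (symplectic_basis_rev b_alt pq').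
  by rewrite !mulr0 mulr1 mulrN1 subr0 sub0r opprK -symplectic_basisE.
pose S := change u v u' v'; pose T := change u' v' u v.
have Su : S u = u' by rewrite changeE uv.2 b_alt scale1r scale0r subr0.
have Sv : S v = v'.
  rewrite changeE b_alt (symplectic_basis_rev b_alt uv).
  by rewrite scale0r sub0r scaleN1r opprK.
have TS : (T \o S)%VF = \1%VF by apply: changeK.
have ST : (S \o T)%VF = \1%VF by apply: changeK.
have isoS w z : b (S w) (S z) = b w z.
  rewrite [in RHS](symplectic_basisE b_alt w uv).
  rewrite [in RHS](symplectic_basisE b_alt z uv) !changeE.
  rewrite !linearBl !linearBr /= !linearZl_LR !linearZr_LR /= !b_alt uv.2 uv'.2.
  by rewrite (symplectic_basis_rev b_alt uv) (symplectic_basis_rev b_alt uv').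
exists (conj_B42 S T); split.
- by exists (conj_B42 T S); apply: conj_B42K.
- exact: conj_B42M.
- exact: conj_B42_main.
by move=> k; rewrite (conj_B42_Gamma ST isoS) ?Su ?Sv.
Qed.

Lemma Gamma_iso_degree u v u' v' (g h : G) :
  symplectic_basis b u v -> symplectic_basis b u' v' ->
  superalg_grading_iso (B42_mul b) (B42_main V) (Gamma u v g) (Gamma u' v' h) ->
  g = h \/ g = - h.
Proof.
move=> uv uv' [f [f_bij _ f_main f_Gam]].
have [->|gh] := eqVneq g h; first by left.
have [->|gNh] := eqVneq g (- h); first by right.
(* The odd generators have degrees [h] and [- h], so in any other degree only even generators
   remain. The image of [u] is then both even and odd, hence zero. *)
have even : (Gamma u' v' h g <= B42_main V 0%R)%VS.
  apply/span_subvP => a /mapP[p]; rewrite mem_filter => /andP[/eqP pg pL] ->.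
  move: pg pL; rewrite (Gamma_degreesE b_alt) // mem_B42_even !inE => pg.
  case/or4P=> [| | |/or3P[| |]] /eqP pE; rewrite pE //=;
    move: pg; rewrite pE /=.
    by move=> hg; rewrite hg eqxx in gh.
  by move=> hg; rewrite hg eqxx in gNh.
have u0 : (0, u) \in Gamma u v g g.
  apply: memv_span; apply/mapP; exists ((0, u), g) => //.
  rewrite mem_filter /= eqxx (Gamma_degreesE b_alt) //.
  by apply/(nthP (0, 0)); exists 2%N.
have : f (0, u) \in B42_main V 0.
  by apply: (subvP even); rewrite -f_Gam memv_img.
have : f (0, u) \in B42_main V 1.
  by rewrite -f_main memv_img // mem_B42_odd.
rewrite mem_B42_odd mem_B42_even => /eqP f1 /eqP f2.
have : f (0, u) = f 0 by rewrite linear0 [LHS]surjective_pairing f1 f2.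
move/(bij_inj f_bij) => -[u_0]; have := uv.2.
by rewrite u_0 linear0l => /eqP; rewrite eq_sym oner_eq0.
Qed.

End Isomorphism.

Theorem theorem17 (F : fieldType) (charF : 3%N \in [pchar F])
    (V : vectType F) (dimV : \dim {:V} = 2%N)
    (b : {biscalar V}) (b_alt : alternating b) (b_nd : nondegenerate_form b)
    (G : zmodType) :
  (forall Gam : G -> {vspace B42 V},
      superalg_grading (B42_mul b) (B42_main V) Gam ->
      exists (g : G) (u v : V),
        symplectic_basis b u v /\ Gam =1 Gamma u v g)
  /\ (forall (u v u' v' : V) (g h : G),
        symplectic_basis b u v -> symplectic_basis b u' v' ->
        superalg_grading_iso (B42_mul b) (B42_main V)
          (Gamma u v g) (Gamma u' v' h)
        <-> g = h \/ g = - h).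
Proof.
split=> [Gam Gam_grading | u v u' v' g h uv uv']; last first.
  split; first exact: Gamma_iso_degree.
  case=> ->; first exact: Gamma_iso_same_degree.
  (* For [g = - h] the target basis is turned to {v', -u'}, where degree parameter [- h] gives the
     same grading as [h] does for {u', v'}. *)
  have [f [fb fM fm fG]] := Gamma_iso_same_degree b_alt (- h) uv
    (symplectic_basis_rot b_alt (mulr1 1) dimV uv').
  exists f; split=> // k; rewrite fG scale1r scaleN1r.
  by rewrite (Gamma_rot b_alt h k dimV uv').
have [w [z wz]] : exists w z, b w z != 0.
  pose X := vbasis {:V}; pose w := vpick {:V}.
  have w0 : w != 0 by rewrite vpick0 -dimv_eq0 dimV.
  (* Searching among finitely many basis vectors makes the existence claim decidable, so it can be
     proved by contraposition. *)
  suff /existsP[i wi] : [exists i : 'I_(\dim {:V}), b w (X`_i) != 0].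
    by exists w, X`_i.
  apply: contraNT w0 => /existsPn orth; apply/eqP/b_nd => z.
  rewrite (coord_vbasis (memvf z)) linear_sumr big1 // => i _.
  by rewrite linearZr_LR /= (eqP (negbNE (orth i))) mulr0.
have [g [h [u [v [ug vh uv]]]]] := homogeneous_nonorthogonal Gam_grading wz.
(* Rescaling [v] alone normalizes the pairing and keeps the vector in its component. *)
have uv1 : symplectic_basis b u ((b u v)^-1 *: v).
  apply: symplectic_basis_intro => //.
  by rewrite linearZr_LR /= mulVf.
exists g, u, ((b u v)^-1 *: v); split=> //.
apply: (grading_eq_Gamma b_alt Gam_grading uv1 ug (h := h)).
have -> : (0, (b u v)^-1 *: v) = (b u v)^-1 *: (0, v) :> B42 V.
  by congr (_, _); rewrite /= scaler0.
by rewrite memvZ.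
Qed.
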